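(* Let $n,s,p$ be positive integers with $s\geq 1$, $p\geq 1$ and $n\geq 7s+6$, and let $\mathcal{H}\subseteq\binom{[n]}{3}$ with $\nu(\mathcal{H})=s$. Then $$co_p(\mathcal{H})\leq co_p(\mathcal{H}_{n,3,s}),$$ with equality if and only if $\mathcal{H}\cong \mathcal{H}_{n,3,s}$.
   Context: $[n]=\{1,\dots,n\}$ and $\binom{[n]}{k}$ is the family of all $k$-element subsets of $[n]$. The matching number $\nu(\mathcal{H})$ is the largest number of pairwise disjoint members of $\mathcal{H}$. For $E\subseteq[n]$, $d_{\mathcal{H}}(E)=|\{F\in\mathcal{H}:E\subseteq F\}|$. For $\mathcal{H}\subseteq\binom{[n]}{3}$, $co_p(\mathcal{H})=\sum_{E\in\binom{[n]}{2}}(d_{\mathcal{H}}(E))^p$. $\mathcal{H}_{n,3,s}=\{F\in\binom{[n]}{3}: F\cap[s]\neq\emptyset\}$. $\cong$ means equality up to a permutation of $[n]$. *)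

(* Defs.v *)
From mathcomp Require Import all_boot all_fingroup.

Set Implicit Arguments.
Unset Strict Implicit.
Unset Printing Implicit Defensive.

(* The ground set [n] = {1, ..., n} is represented by 'I_n = {0, ..., n-1}. *)

Definition ksubsets (T : finType) (k : nat) : {set {set T}} :=
  [set F : {set T} | #|F| == k].

Definition matching_number (T : finType) (H : {set {set T}}) : nat :=
  \max_(M : {set {set T}} | (M \subset H) && trivIset M) #|M|.

Definition degree (T : finType) (H : {set {set T}}) (E : {set T}) : nat :=
  #|[set F in H | E \subset F]|.

Definition co (T : finType) (p : nat) (H : {set {set T}}) : nat :=
  \sum_(E in ksubsets T 2) degree H E ^ p.

(* [s] = {1, ..., s} becomes the set of the ordinals i < s. *)
Definition initial_set (n s : nat) : {set 'I_n} := [set i : 'I_n | i < s].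

Definition Hfam (n k s : nat) : {set {set 'I_n}} :=
  [set F in ksubsets 'I_n k | F :&: initial_set n s != set0].

Definition family_iso (T : finType) (H G : {set {set T}}) : Prop :=
  exists sigma : {perm T}, H = [set sigma @: F | F : {set T} in G].

(* Main.v *)
(* Write N = n - 2 and (t)^+ = max(t, 0). The chord of x^p over [s, N] gives
   d^p <= s^(p-1) min(d, s) + b (d - s)^+ for 0 <= d <= N, with equality at
   d = s and d = N, the only pair degrees of H_{n,3,s}. Hence it suffices to
   bound the excess K(H), the sum of (d(E) - s)^+ over all pairs E, by
   K(H_{n,3,s}), and to characterise equality there.

   K does not decrease under the shift replacing j by i < j, so assume H is
   stable under these shifts. Let T = {0, ..., s}, X its complement,
   m = n - s - 1 = |X|, and let G_i be the link graph of i in T, restricted to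
   X. Bounding the pairs inside T, between T and X, and inside X separately,
     2 K(H) <= s (s+1) (m-1) + 2 sum_(i < s) g_i + (3s+3) g_s,
   where g_i = 2 |G_i|: a pair in X has excess only if it lies in G_s, and the
   members of H inside X number at most s |G_s|, since all but one of the
   elements of such a member are at most 3s. The G_i are nested, and
   nu(H) <= s forbids a rainbow matching of G_0, ..., G_s. Splitting the pairs
   of X into the matchings {y + z = c mod m}, this yields
     2 sum_(i < s) g_i + (3s+4) g_s <= 2 s m (m-1),
   hence 2 K(H) + g_s <= 2 K(H_{n,3,s}). Equality forces g_s = 0, so that
   every member of H meets {0, ..., s-1}. Finally, if a shift of H consists of
   all triples meeting some s-set, then so does H. *)
Require Import Defs.
From mathcomp Require Import all_boot all_fingroup.
From mathcomp Require Import zify.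

Set Implicit Arguments.
Unset Strict Implicit.
Unset Printing Implicit Defensive.

(** * Matchings as sequences, stars and excess *)

Definition matching (T : finType) (H : {set {set T}}) (l : seq {set T}) :=
  all [in H] l && pairwise (fun A B : {set T} => [disjoint A & B]) l.

(** The extremal family on an arbitrary centre [S]: [Hfam n 3 s] is convertible to
    [star (initial_set n s)]. *)
Definition star (T : finType) (S : {set T}) : {set {set T}} :=
  [set F in ksubsets T 3 | F :&: S != set0].

(** This is [K(H)]: truncated subtraction supplies the positive part. *)
Definition excess (T : finType) (s : nat) (H : {set {set T}}) : nat :=
  \sum_(E in ksubsets T 2) (degree H E - s).

Lemma pairwise_disjoint (T : finType) (l : seq {set T}) :
    pairwise (fun A B : {set T} => [disjoint A & B]) l ->
  forall A B, A \in l -> B \in l -> A != B -> [disjoint A & B].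
Proof.
move/(pairwiseP set0) => dl A B Al Bl AB.
case: (ltngtP (index A l) (index B l)) => [lt|lt|eq].
- by have := dl _ _ _ _ lt; rewrite !inE !index_mem !nth_index //; apply.
- rewrite disjoint_sym.
  by have := dl _ _ _ _ lt; rewrite !inE !index_mem !nth_index //; apply.
- by move: AB; rewrite -(nth_index set0 Al) eq nth_index // eqxx.
Qed.

(** The empty set is disjoint from itself and could repeat in a sequence. Once it is excluded,
    pairwise disjoint terms are distinct, so the sequence is a set competing in the maximum. *)
Lemma matching_size (T : finType) (H : {set {set T}}) (l : seq {set T}) :
  set0 \notin H -> matching H l -> size l <= matching_number H.
Proof.
move=> H0 /andP[/allP lH dl].
have ul : uniq l.
  elim: l lH dl => //= A l IH lH /andP[/allP dA dl].
  rewrite IH ?andbT //; last by move=> B Bl; apply: lH; rewrite inE Bl orbT.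
  apply/negP => /dA; rewrite -setI_eq0 setIid => /eqP A0.
  by move: (lH A); rewrite !inE eqxx A0 => /(_ isT); apply/negP.
have -> : size l = #|[set A in l]| by rewrite cardsE; apply/esym/card_uniqP.
apply: (@leq_bigmax_cond _ _ (fun M : {set {set T}} => #|M|) [set A in l]).
apply/andP; split; first by apply/subsetP => A; rewrite inE => /lH.
apply/trivIsetP => A B; rewrite !inE => Al Bl AB.
exact: pairwise_disjoint dl _ _ Al Bl AB.
Qed.

(** Greedy choice: each element of [S] takes two fresh points of [R]. *)
Lemma star_matching (T : finType) (H : {set {set T}}) (S R : {set T}) :
    {in S, forall u, {in R &, forall p q, p != q -> [set u; p; q] \in H}} ->
    [disjoint S & R] -> 2 * #|S| <= #|R| ->
  exists l, [/\ matching H l, size l = #|S| &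
                forall A, A \in l -> A \subset S :|: R].
Proof.
have [k] := ubnP #|S|; elim: k S R => // k IH S R; rewrite ltnS => Sk hH dSR cSR.
have [->|[u uS]] := set_0Vmem S; first by exists [::]; rewrite cards0.
have cS : #|S| = #|S :\ u|.+1 by rewrite (cardsD1 u S) uS.
have /card_gt0P[p pR] : 0 < #|R| by lia.
have cR1 := cardsD1 p R; rewrite pR /= in cR1.
have /card_gt0P[q] : 0 < #|R :\ p| by lia.
rewrite !inE => /andP[qp qR].
have cR2 := cardsD1 q (R :\ p); rewrite !inE qp qR /= in cR2.
have sR : R :\ p :\ q \subset R by apply/subsetP => x; rewrite !inE => /and3P[].
have sS : S :\ u \subset S by apply/subsetP => x; rewrite !inE => /andP[].
have [||||l [/andP[lH dl] sl subl]] := IH (S :\ u) (R :\ p :\ q).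
- by lia.
- move=> v vS x y xR yR.
  by apply: hH; [apply: (subsetP sS)|apply: (subsetP sR)|apply: (subsetP sR)].
- exact: disjointWl sS (disjointWr sR dSR).
- by lia.
exists ([set u; p; q] :: l); split; last 1 first.
- move=> A; rewrite inE => /orP[/eqP->|/subl].
    by apply/subsetP => x; rewrite !inE => /orP[/orP[]|] /eqP->;
       rewrite ?uS ?pR ?qR ?orbT.
  by move/subset_trans; apply; apply: setUSS.
- have pq : p != q by rewrite eq_sym.
  rewrite /matching /= lH dl hH //= andbT.
  apply/allP => A /subl /subsetP Asub; rewrite -setI_eq0; apply/eqP/setP => x.
  rewrite !inE; apply/negP => /andP[+ /Asub]; rewrite !inE.
  case/orP=> [/orP[]|] /eqP->; rewrite ?eqxx ?andbF //=.
  + by rewrite (disjointFr dSR uS) !andbF.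
  + by rewrite (disjointFl dSR pR) !andbF.
  + by rewrite (disjointFl dSR qR) !andbF.
- by rewrite /= sl cS.
Qed.

(** * Shifting a family from [j] to [i] *)

Section Shift.

Variables (T : finType) (i j : T).
Implicit Types (H : {set {set T}}) (A E : {set T}).

Definition swap A : {set T} := tperm i j @: A.

(** Acts separately on each orbit of [swap]: if just one of [A] and [swap A] is in [H], the one
    containing [i] is kept. *)
Definition shift H : {set {set T}} :=
  [set A : {set T} | if (i \in A) == (j \in A) then A \in H
           else if i \in A then (A \in H) || (swap A \in H)
           else (A \in H) && (swap A \in H)].

Lemma mem_swap A x : (x \in swap A) = (tperm i j x \in A).
Proof. by rewrite -{1}(tpermK i j x) mem_imset //; apply: perm_inj. Qed.

Lemma swapK : involutive swap.
Proof. by move=> A; apply/setP => x; rewrite !mem_swap tpermK. Qed.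

Lemma swap_id A : (i \in A) = (j \in A) -> swap A = A.
Proof.
by move=> e; apply/setP => x; rewrite mem_swap; case: tpermP => // ->.
Qed.

Lemma card_swap A : #|swap A| = #|A|.
Proof. by rewrite card_imset //; apply: perm_inj. Qed.

Lemma swap_sub E A : (swap E \subset swap A) = (E \subset A).
Proof.
apply/idP/idP; last exact: imsetS.
by move/(imsetS (tperm i j)); rewrite -/(swap (swap E)) -/(swap (swap A)) !swapK.
Qed.

Lemma shift_sum H A :
  (A \in shift H) + (swap A \in shift H) = (A \in H) + (swap A \in H).
Proof.
rewrite !inE !mem_swap tpermL tpermR swapK.
case iA: (i \in A); case jA: (j \in A) => //=;
  by case: (A \in H); case: (swap A \in H).
Qed.

Lemma degreeE H E : degree H E = \sum_(A : {set T} | E \subset A) (A \in H).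
Proof.
rewrite /degree -sum1_card big_mkcond [RHS]big_mkcond /=.
by apply: eq_bigr => A _; rewrite !inE; case: (A \in H); case: (E \subset A).
Qed.

Lemma degree_swapE H E :
  degree H (swap E) = \sum_(A : {set T} | E \subset A) (swap A \in H).
Proof.
rewrite degreeE (reindex_inj (inv_inj swapK)) /=.
by apply: eq_bigl => A; rewrite swap_sub.
Qed.

Lemma degree_shift_sum H E :
  degree (shift H) E + degree (shift H) (swap E) =
  degree H E + degree H (swap E).
Proof.
rewrite !degree_swapE !degreeE -!big_split /=.
by apply: eq_bigr => A _; apply: shift_sum.
Qed.

Lemma degree_shift_max H E : i \in E -> j \notin E ->
  degree H E <= degree (shift H) E /\ degree H (swap E) <= degree (shift H) E.
Proof.
move=> iE jE; rewrite degree_swapE !degreeE.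
split; apply: leq_sum => A /subsetP EA; rewrite !inE (EA _ iE) /=;
  case jA: (j \in A) => //=.
- by case: (A \in H).
- by rewrite swap_id // jA (EA _ iE).
- by case: (A \in H); case: (swap A \in H).
Qed.

(** On the orbit of a pair [E] the shift preserves the sum of the two degrees and does not lower
    their maximum. Since the positive part of [d - s] is convex in [d], its sum over the orbit
    cannot drop. *)
Lemma excess_shift s H : excess s H <= excess s (shift H).
Proof.
(* Doubling the sum attaches to every [E] its partner [swap E]. *)
have re F : 2 * (\sum_(E in ksubsets T 2) F E) =
    \sum_(E in ksubsets T 2) (F E + F (swap E)).
  rewrite big_split /= mul2n -addnn; congr addn.
  rewrite (reindex_inj (inv_inj swapK)) /=.
  by apply: eq_bigl => A; rewrite !inE card_swap.
rewrite /excess -(leq_pmul2l (isT : 0 < 2)) !re; apply: leq_sum => E _.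
have := degree_shift_sum H E.
case: (boolP (i \in E)) => iE; case: (boolP (j \in E)) => jE.
- by rewrite swap_id ?iE ?jE //; lia.
- by have := degree_shift_max H iE jE; lia.
- have := @degree_shift_max H (swap E); rewrite !mem_swap tpermL tpermR swapK.
  by move=> /(_ jE iE); lia.
- by rewrite swap_id ?(negbTE iE) ?(negbTE jE) //; lia.
Qed.

Lemma shift_uniform H k : H \subset ksubsets T k -> shift H \subset ksubsets T k.
Proof.
move/subsetP => Hk; apply/subsetP => A; rewrite inE.
have sw : swap A \in H -> A \in ksubsets T k.
  by move/Hk; rewrite !inE card_swap.
case: ifP => _; first exact: Hk.
by case: ifP => _; [case/orP; [apply: Hk|apply: sw] | case/andP => /Hk].
Qed.

(** A term [A] of the matching outside [H] contains [i] but not [j], and [swap A] is in [H]. The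
    other terms avoid [i], and for such members of the shift the swapped set is in [H] as well; so
    swapping all terms gives a matching of [H]. *)
Lemma shift_matching H l : matching (shift H) l ->
  matching H l \/ matching H (map swap l).
Proof.
case/andP => /allP lH dl.
have [aH|] := boolP (all [in H] l); first by left; rewrite /matching aH.
case/allPn => A Al AH; right; rewrite /matching all_map pairwise_map.
have Ash := lH A Al; rewrite inE in Ash.
have [iA jA sA] : [/\ i \in A, j \notin A & swap A \in H].
  move: Ash; rewrite (negbTE AH); case: (i \in A); case: (j \in A) => //=.
apply/andP; split; last first.
  apply: sub_pairwise dl => B C /=; rewrite -!setI_eq0 => /eqP BC.
  rewrite /swap -imsetI; last by move=> x y _ _; apply: perm_inj.
  by rewrite BC imset0.
apply/allP => B Bl /=; have [->//|BA] := eqVneq B A.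
have iB : i \notin B.
  have /disjointFr-> // : [disjoint A & B].
  by apply: pairwise_disjoint dl _ _ Al Bl _; rewrite eq_sym.
have := lH B Bl; rewrite /= inE (negbTE iB).
case: (boolP (j \in B)) => /= jB; first by case/andP.
by rewrite swap_id // (negbTE iB) (negbTE jB).
Qed.

End Shift.

(** The measure that makes repeated shifting terminate. *)
Definition weight (n : nat) (H : {set {set 'I_n}}) : nat :=
  \sum_(A in H) \sum_(x in A) x.

Lemma weight_shift (n : nat) (i j : 'I_n) (H : {set {set 'I_n}}) :
  i < j -> shift i j H != H -> weight (shift i j H) < weight H.
Proof.
move=> ij neH; pose w (A : {set 'I_n}) := \sum_(x in A) x.
have w_swap (A : {set 'I_n}) : i \in A -> j \notin A -> w (swap i j A) + i = w A + j.
  move=> iA jA; rewrite /w big_imset /=; last by move=> x y _ _; apply: perm_inj.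
  rewrite !(bigD1 i iA) /= tpermL addnC addnCA [RHS]addnC; congr (_ + (_ + _)).
  apply: eq_bigr => x /andP[xA xi]; rewrite tpermD //; first by rewrite eq_sym.
  by apply: contraNneq jA => ->.
have re G : 2 * weight G =
    \sum_(A : {set 'I_n}) ((A \in G) * w A + (swap i j A \in G) * w (swap i j A)).
  rewrite big_split /= mul2n -addnn; congr addn.
    by rewrite /weight big_mkcond; apply: eq_bigr => A _; case: (A \in G);
      rewrite ?mul1n.
  rewrite /weight (reindex_inj (inv_inj (@swapK _ i j))) big_mkcond /=.
  by apply: eq_bigr => A _; case: ifP; rewrite ?mul1n.
have [A0 neA] : exists A, (A \in shift i j H) != (A \in H).
  apply/existsP; rewrite -negb_forall; apply: contra neH => /forallP eqA.
  by apply/eqP/setP => A; apply/eqP.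
(* Orbit by orbit the weight never grows, and it loses at least [j - i] where membership changes. *)
have le A : ((A \in shift i j H) * w A +
     (swap i j A \in shift i j H) * w (swap i j A)) + ((A \in shift i j H) != (A
       \in H)) <=
    ((A \in H) * w A + (swap i j A \in H) * w (swap i j A)).
  have := w_swap A; have := w_swap (swap i j A).
  rewrite !inE !mem_swap tpermL tpermR swapK.
  case: (i \in A); case: (j \in A) => /=; case: (A \in H);
    case: (swap i j A \in H) => /=; rewrite ?mul1n ?mul0n;
    do ?[move/(_ isT isT)]; move=> *; do ?[match goal with h : _ -> _ |- _ =>
      move: (h isT isT); clear h end]; lia.
rewrite -(ltn_pmul2l (isT : 0 < 2)) !re !(bigD1 A0 (isT : xpredT A0)) /=.
rewrite -addSn leq_add //; first by have := le A0; rewrite neA addn1.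
by apply: leq_sum => A _; apply: leq_trans (le A); rewrite leq_addr.
Qed.

(** * Undoing a shift whose result is a star *)

Lemma mem_star (T : finType) (S A : {set T}) :
  (A \in star S) = (#|A| == 3) && (A :&: S != set0).
Proof. by rewrite !inE. Qed.

Lemma set3_star (T : finType) (S : {set T}) (a b c : T) :
    #|[set a; b; c]| = 3 ->
  ([set a; b; c] \in star S) = [|| a \in S, b \in S | c \in S].
Proof.
move=> c3; rewrite mem_star c3 eqxx /=; apply/set0Pn/idP.
  by case=> x; rewrite !inE => /andP[/orP[/orP[]|] /eqP-> ->]; rewrite ?orbT.
by case/or3P => ?; [exists a|exists b|exists c]; rewrite !inE eqxx ?orbT.
Qed.

Lemma card_set3 (T : finType) (a b c : T) :
  a != b -> a != c -> b != c -> #|[set a; b; c]| = 3.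
Proof.
move=> ab ac bc.
by rewrite setUC cardsU1 cards2 ab !inE negb_or eq_sym ac eq_sym bc.
Qed.

Lemma swap_set3 (T : finType) (i j a b : T) :
    a != i -> a != j -> b != i -> b != j ->
  swap i j [set i; a; b] = [set j; a; b].
Proof.
move=> ai aj bi bj; apply/setP => x; rewrite mem_swap !inE.
case: tpermP => [->|->|/eqP/negbTE xi /eqP/negbTE xj].
- by rewrite ![j == _]eq_sym ![i == _]eq_sym (negbTE ai) (negbTE aj) (negbTE bi)
  (negbTE bj) !orbF.
- by rewrite !eqxx.
- by rewrite xi xj.
Qed.

Lemma cards_diff4 (T : finType) (R : {set T}) (a b c d : T) :
  #|R| - 4 <= #|R :\: [set a; b; c; d]|.
Proof.
have c4 : #|[set a; b; c; d]| <= 4.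
  by rewrite setUC cardsU1 setUC cardsU1 cards2; lia.
have := cardsID [set a; b; c; d] R.
by have := subset_leq_card (subsetIr R [set a; b; c; d]); lia.
Qed.

(* The pairs outside [j |: S] are coloured by which of [i] and [j] completes
   them to a member of [H].  Two disjoint pairs of different colours would
   extend to a matching of size [#|S|.+1], and any two pairs are disjoint from
   a common third one, so the colouring is constant. *)
Lemma shift_star (T : finType) (i j : T) (H : {set {set T}}) (S : {set T}) :
    i != j -> 0 < #|S| -> 3 * #|S| + 6 <= #|T| -> H \subset ksubsets T 3 ->
    (forall l, matching H l -> size l <= #|S|) -> shift i j H = star S ->
  exists2 S' : {set T}, #|S'| = #|S| & H = star S'.
Proof.
move=> ij S0 cT /subsetP H3 nuH eqH.
have ijF : (i == j) = false by apply/negbTE.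
have jiF : (j == i) = false by rewrite eq_sym.
have eqA (A : {set T}) : (if (i \in A) == (j \in A) then A \in H
              else if i \in A then (A \in H) || (swap i j A \in H)
              else (A \in H) && (swap i j A \in H)) = (A \in star S).
  by rewrite -eqH inE.
(* Here [star S] is invariant under [swap], and an orbit wholly inside or outside the shift was not
   altered by it. *)
have [ijS|ijS] := eqVneq (i \in S) (j \in S).
  exists S => //; apply/setP => A; have := eqA A; have := eqA (swap i j A).
  have -> : (swap i j A \in star S) = (A \in star S).
    rewrite !mem_star card_swap -{1}(swap_id ijS) /swap -imsetI ?imset_eq0 //.
    by move=> x y _ _; apply: perm_inj.
  rewrite !mem_swap tpermL tpermR swapK.
  by case: (i \in A); case: (j \in A) => //=; case: (A \in H);
     case: (swap i j A \in H); case: (A \in star S).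
have cR := cardsC (i |: (j |: S)).
have cU : #|i |: (j |: S)| = #|S|.+1.
  by rewrite !cardsU1 !inE (negbTE ij); move: ijS; case: (i \in S); case: (j \in S).
pose R := ~: (i |: (j |: S)); rewrite -/R cU in cR.
have inR x : x \in R -> [/\ x != i, x != j & x \notin S].
  by rewrite !inE !negb_or => /and3P[].
have pick4 (a b c d : T) : exists p q, [/\ p \in R, q \in R, p != q,
    p \notin [set a; b; c; d] & q \notin [set a; b; c; d]].
  have /card_gt1P[p [q [pR qR pq]]] : 1 < #|R :\: [set a; b; c; d]|.
    apply: leq_trans (cards_diff4 _ _ _ _ _); move: cR cT S0; clear; lia.
  exists p, q; move: pR qR; rewrite !in_setD => /andP[-> ->] /andP[-> ->]; by [].
have iab a b : a \in R -> b \in R -> a != b ->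
    [/\ #|[set i; a; b]| = 3, #|[set j; a; b]| = 3
      & swap i j [set i; a; b] = [set j; a; b]].
  move=> /inR[ai aj _] /inR[bi bj _] ab.
  by rewrite swap_set3 // !card_set3 // eq_sym.
(* Were [j] in [S] and [i] not, [[set j; p; q]] would survive the shift, which requires
   [[set i; p; q]] in [H] and hence in the star, although it misses [S]. *)
have [iS jS] : i \in S /\ j \notin S.
  move: ijS; case: (boolP (i \in S)); case: (boolP (j \in S)) => // jS iS _.
  have [p [q [pR qR pq _ _]]] := pick4 i i i i.
  have [c3i c3j sw] := iab p q pR qR pq.
  have [pi pj pS] := inR p pR; have [qi qj qS] := inR q qR.
  have := eqA [set i; p; q]; have := eqA [set j; p; q].
  rewrite -sw swapK sw !set3_star // (negbTE iS) jS (negbTE pS) (negbTE qS) /=.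
  rewrite !inE !eqxx ![j == _]eq_sym ![i == _]eq_sym (negbTE pi) (negbTE qi)
    (negbTE pj) (negbTE qj).
  rewrite ?ijF ?jiF /=.
  by case/andP => -> ->.
(* If [A] meets [S :\ i], both [A] and [swap A] are in the star, so both were in [H]. *)
have meetH (A : {set T}) : A \in star S -> A :&: (S :\ i) != set0 -> A \in H.
  move=> AS /set0Pn[u]; rewrite !inE => /and3P[uA ui uS].
  have uj : u != j by apply: contraNneq jS => <-.
  have swS : swap i j A \in star S.
    move: AS; rewrite !mem_star card_swap => /andP[-> _]; apply/set0Pn; exists u.
    by rewrite inE mem_swap tpermD ?uA // eq_sym.
  have := eqA A; have := eqA (swap i j A).
  rewrite AS swS !mem_swap tpermL tpermR swapK.
  by case: (i \in A); case: (j \in A) => //=; case: (A \in H);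
     case: (swap i j A \in H).
(* The star contains [[set i; a; b]] but not [[set j; a; b]], so exactly one of them was in [H]. *)
have one a b : a \in R -> b \in R -> a != b ->
    ([set j; a; b] \in H) = ([set i; a; b] \notin H).
  move=> aR bR ab; have [c3i c3j sw] := iab a b aR bR ab.
  have [ai aj aS] := inR a aR; have [bi bj bS] := inR b bR.
  have := eqA [set i; a; b]; have := eqA [set j; a; b].
  rewrite -sw swapK sw !set3_star // iS (negbTE jS) (negbTE aS) (negbTE bS) /=.
  rewrite !inE !eqxx ![j == _]eq_sym ![i == _]eq_sym (negbTE ai) (negbTE aj)
    (negbTE bi) (negbTE bj).
  rewrite ?ijF ?jiF /=.
  by case: (_ \in H); case: (_ \in H).
have disj a b c d : a \in R -> b \in R -> c \in R -> d \in R -> a != b -> c != d ->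
    c \notin [set a; b] -> d \notin [set a; b] ->
    [set i; a; b] \in H -> [set i; c; d] \in H.
  move=> aR bR cR' dR ab cd; rewrite !inE !negb_or => /andP[ca cb] /andP[da db] Hab.
  apply: contraT; rewrite -one // => Hcd.
  have [ai aj aS] := inR a aR; have [bi bj bS] := inR b bR.
  have [ci cj cS] := inR c cR'; have [di dj dS] := inR d dR.
  pose R' := R :\: [set a; b; c; d].
  have cS1 := cardsD1 i S; rewrite iS /= in cS1.
  (* The elements of [S :\ i] give [#|S| - 1] disjoint members avoiding [a], [b], [c], [d]; with the
     two coloured triples this exceeds [#|S|]. *)
  have [||| l [/andP[lH dl] sl subl]] := @star_matching _ H (S :\ i) R'.
  - move=> u; rewrite !inE => /andP[ui uS] p q.
    rewrite !in_setD => /andP[_ pR] /andP[_ qR] pq.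
    have [pi pj pS] := inR p pR; have [qi qj qS] := inR q qR.
    have c3 : #|[set u; p; q]| = 3.
      by rewrite card_set3 //; [apply: contraNneq pS => <-|apply: contraNneq qS => <-].
    apply: meetH; first by rewrite set3_star // uS.
    by apply/set0Pn; exists u; rewrite !inE eqxx ui uS.
  - rewrite -setI_eq0; apply/eqP/setP => x; rewrite !inE.
    by case: (x \in S); rewrite ?andbF ?orbT ?andbF.
  - apply: leq_trans (cards_diff4 _ _ _ _ _).
    by move: cR cT S0 cS1; clear; lia.
  have dis (A : {set T}) x : A \in l -> x \in [set i; a; b; j; c; d] -> x \in A = false.
    move=> /subl/subsetP Al xi; apply/negP => /Al; rewrite !inE.
    by move: xi; rewrite !inE -!orbA => /or4P[/eqP->|/eqP->|/eqP->|/or3P[]/eqP->];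
      rewrite ?eqxx ?(negbTE aS) ?(negbTE bS) ?(negbTE cS) ?(negbTE dS) ?(negbTE
        jS) /= ?andbF ?orbT ?andbF.
  have al x y z : [set x; y; z] \subset [set i; a; b; j; c; d] ->
      all (fun B : {set T} => [disjoint [set x; y; z] & B]) l.
    move=> /subsetP sub; apply/allP => A Al; rewrite -setI_eq0.
    apply/eqP/setP => v; rewrite in_setI in_set0; apply/negP => /andP[/sub v6].
    by rewrite (dis A).
  have := nuH ([set i; a; b] :: [set j; c; d] :: l).
  rewrite /matching /= Hab Hcd lH dl sl cS1 !al; last 2 first.
  - by apply/subsetP => x; rewrite !inE => /orP[/orP[]|]->; rewrite ?orbT.
  - by apply/subsetP => x; rewrite !inE => /orP[/orP[]|]->; rewrite ?orbT.
  rewrite !andbT ltnn => -> //.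
  rewrite -setI_eq0; apply/eqP/setP => x; rewrite !inE; apply/negP.
  case/andP => /orP[/orP[]|] /eqP->.
  + by rewrite (negbTE ij) ![i == _]eq_sym (negbTE ci) (negbTE di).
  + by rewrite (negbTE aj) ![a == _]eq_sym (negbTE ca) (negbTE da).
  + by rewrite (negbTE bj) ![b == _]eq_sym (negbTE cb) (negbTE db).
have const a b c d : a \in R -> b \in R -> c \in R -> d \in R -> a != b -> c != d ->
    [set i; a; b] \in H -> [set i; c; d] \in H.
  move=> aR bR cR' dR ab cd Hab; have [p [q [pR qR pq p4 q4]]] := pick4 a b c d.
  move: p4 q4; rewrite !inE !negb_or -!andbA => /and4P[pa pb pc pd] /and4P[qa qb qc qd].
  have Hpq : [set i; p; q] \in H.
    by apply: disj Hab; rewrite // !inE negb_or ?pa ?pb ?qa ?qb.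
  by apply: disj Hpq; rewrite // !inE negb_or ![_ == p]eq_sym ![_ == q]eq_sym ?pc
    ?pd ?qc ?qd.
have decomp (A : {set T}) x : #|A| = 3 -> x \in A -> A :&: (S :\ i) = set0 ->
    A :\ x \subset ~: [set i; j] ->
    exists a b, [/\ a \in R, b \in R, a != b & A = [set x; a; b]].
  move=> c3 xA AS /subsetP Ax; have := cardsD1 x A; rewrite c3 xA =>
    -[/esym/eqP/cards2P].
  case=> a [b [ab eqAx]]; exists a, b.
  have AxR y : y \in A :\ x -> y \in R.
    move=> yA; have := Ax _ yA; move: yA; rewrite !inE => /andP[yx yA].
    rewrite !negb_or => /andP[-> ->] /=; apply/negP => yS.
    by move/setP/(_ y): AS; rewrite !inE yA yS andbT /=; have := Ax y;
      rewrite !inE yx yA !negb_or => /(_ isT)/andP[->].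
  split=> //; try by apply: AxR; rewrite eqAx !inE eqxx ?orbT.
  by rewrite -(setD1K xA) eqAx setUA.
have [p0 [q0 [p0R q0R pq0 _ _]]] := pick4 i i i i.
(* Treats both colours at once: [r] is the element of [[set i; j]] that completes every outside
   pair. *)
have fin r r' : r \in [set i; j] -> [set r; r'] = [set i; j] ->
    (forall a b, a \in R -> b \in R -> a != b ->
       ([set r; a; b] \in H) && ([set r'; a; b] \notin H)) ->
    H = star (r |: (S :\ i)).
  move=> rij eq_rr Hr; apply/setP => A; apply/idP/idP => [AH|AS].
    have c3 : #|A| = 3 by have := H3 _ AH; rewrite inE => /eqP.
    rewrite mem_star c3 eqxx /=; apply: contraT; rewrite negbK.
    rewrite setIUr setU_eq0 => /andP[rA /eqP AS].
    have {}rA : r \notin A.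
      by apply: contraTN rA => rA; apply/set0Pn; exists r; rewrite !inE eqxx rA.
    have [r'A|r'A] := boolP (r' \in A).
      have [|a [b [aR bR ab eqAx]]] := decomp A r' c3 r'A AS.
        apply/subsetP => y; rewrite -eq_rr !inE negb_or => /andP[-> yA].
        by rewrite andbT; apply: contraNneq rA => <-.
      by have := Hr a b aR bR ab; rewrite -eqAx AH andbF.
    have ijA : (i \notin A) && (j \notin A).
      have n2 y : y \in [set i; j] -> y \notin A.
        by rewrite -eq_rr !inE => /orP[]/eqP->.
      by rewrite !n2 // !inE eqxx ?orbT.
    have := eqA A; case/andP: ijA => iA jA; rewrite (negbTE iA) (negbTE jA) eqxx AH.
    rewrite mem_star => /esym/andP[_ /set0Pn[u]]; rewrite inE => /andP[uA uS].
    move/setP/(_ u): AS; rewrite !inE uA uS andbT /= => /negbFE/eqP ui.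
    by rewrite -ui uA in iA.
  have c3 : #|A| = 3 by move: AS; rewrite mem_star => /andP[/eqP].
  have [AS0|AS0] := eqVneq (A :&: (S :\ i)) set0; last first.
    apply: meetH => //; rewrite mem_star c3 eqxx; case/set0Pn: AS0 => u.
    by rewrite !inE => /and3P[uA _ uS]; apply/set0Pn; exists u; rewrite inE uA.
  have rA : r \in A.
    move: AS; rewrite mem_star setIUr AS0 setU0 => /andP[_ /set0Pn[u]].
    by rewrite !inE => /andP[uA /eqP <-].
  have [r'A|r'A] := boolP (r' \in A).
    have n2 y : y \in [set i; j] -> y \in A.
      by rewrite -eq_rr !inE => /orP[]/eqP->.
    have iA : i \in A by apply: n2; rewrite !inE eqxx.
    have jA : j \in A by apply: n2; rewrite !inE eqxx orbT.
    have := eqA A; rewrite iA jA /= => ->.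
    by rewrite mem_star c3 eqxx; apply/set0Pn; exists i; rewrite inE iA.
  have [|a [b [aR bR ab eqAx]]] := decomp A r c3 rA AS0.
    apply/subsetP => y; rewrite -eq_rr !inE negb_or => /andP[-> yA] /=.
    by apply: contraNneq r'A => <-.
  by have := Hr a b aR bR ab; rewrite -eqAx => /andP[].
have cS1 := cardsD1 i S; rewrite iS /= in cS1.
have [col|col] := boolP ([set i; p0; q0] \in H).
  exists (i |: (S :\ i)); first by rewrite setD1K.
  apply: (fin i j); rewrite ?inE ?eqxx // => a b aR bR ab.
  by rewrite one // negbK andbb (const p0 q0).
exists (j |: (S :\ i)).
  by rewrite cardsU1 !inE (negbTE jS) andbF cS1.
apply: (fin j i); rewrite ?inE ?eqxx ?orbT // ?[[set j; i]]setUC // => a b aR bR ab.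
rewrite one // andbb; apply: contra col; exact: const.
Qed.

(** * Counting with ordered pairs and triples *)

Lemma sum_pairs (T : finType) (F : {set T} -> nat) :
  2 * (\sum_(E in ksubsets T 2) F E) =
  \sum_(x : T) \sum_(y : T | y != x) F [set x; y].
Proof.
rewrite pair_big_dep /= (partition_big (fun p : T * T => [set p.1; p.2])
   (fun E : {set T} => E \in ksubsets T 2)) /=; last first.
  by move=> [x y] /= yx; rewrite inE cards2 [x == y]eq_sym yx.
rewrite big_distrr /=; apply: eq_bigr => E; rewrite inE => /cards2P[a [b [ab ->]]].
rewrite (eq_bigr (fun _ => F [set a; b])); last by move=> p /andP[_ /eqP->].
rewrite sum_nat_const; congr (_ * _).
rewrite (_ : #|_| = #|[set (a, b); (b, a)]|).
  by rewrite cards2 xpair_eqE (negbTE ab).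
apply: eq_card => -[x y]; rewrite inE [LHS]/= !inE !xpair_eqE /=.
apply/andP/orP => [[yx /eqP/setP eqE]|[|] /andP[/eqP-> /eqP->]]; last 2 first.
- by rewrite eq_sym ab eqxx.
- by rewrite ab setUC eqxx.
have := eqE x; have := eqE y; rewrite !inE !eqxx orbT /=; move: yx.
move=> + /esym/orP[]/eqP ya /esym/orP[]/eqP xa; rewrite xa ya ?eqxx // => _.
- by right.
- by left.
Qed.

Lemma set3P (T : finType) (a b c : T) :
  #|[set a; b; c]| = 3 -> [/\ a != b, a != c & b != c].
Proof.
rewrite setUC cardsU1 cards2 !inE negb_or ![c == _]eq_sym.
by case: (a == b); case: (a == c); case: (b == c).
Qed.

(** Every [z] may be summed over: if [z] is [x] or [y] the set has two elements and is not in
    [H]. *)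
Lemma degree_pair (T : finType) (H : {set {set T}}) (x y : T) :
    H \subset ksubsets T 3 -> x != y ->
  degree H [set x; y] = \sum_(z : T) ([set x; y; z] \in H).
Proof.
move=> /subsetP H3 xy.
have c3 A : A \in H -> #|A| = 3 by move/H3; rewrite inE => /eqP.
rewrite -big_mkcond /= sum1_card /degree.
rewrite -(card_in_imset (f := fun z => [set x; y; z])) /=; last first.
  move=> z z' /c3/set3P[_ xz yz] /c3/set3P[_ xz' yz'] /setP/(_ z).
  rewrite !inE eqxx orbT ![z == _]eq_sym (negbTE xz) (negbTE yz) /=.
  by move/esym/eqP.
apply: eq_card => A; rewrite !inE; apply/andP/imsetP => [[AH sA]|[z zH ->]].
  have : #|A :\: [set x; y]| == 1.
    by rewrite cardsD (setIidPr sA) c3 // cards2 xy.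
  case/cards1P => z eqAz; have eqA : A = [set x; y; z].
    by rewrite -eqAz -{1}(setIidPr sA) setID.
  by exists z; rewrite // unfold_in -eqA.
by split=> //; apply/subsetP => v; rewrite !inE => ->.
Qed.

Definition triple (T : finType) (H : {set {set T}}) (x y z : T) : bool :=
  [set x; y; z] \in H.

Lemma tripleC (T : finType) (H : {set {set T}}) (x y z : T) :
  triple H x y z = triple H y x z.
Proof. by rewrite /triple [[set x; y]]setUC. Qed.

Lemma tripleAC (T : finType) (H : {set {set T}}) (x y z : T) :
  triple H x y z = triple H x z y.
Proof. by rewrite /triple setUAC. Qed.

Lemma card_interval (n a b : nat) :
  b <= n -> #|[set x : 'I_n | a <= x < b]| = b - a.
Proof.
move=> bn.
have lt k : k <= n -> \sum_(x < n | x < k) 1 = k.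
  by move=> kn; rewrite -(big_ord_widen n (fun _ => 1) kn) sum1_card card_ord.
have [ab|ba] := leqP a b; last first.
  rewrite (_ : [set x | _] = set0) ?cards0; first by lia.
  by apply/setP => x; rewrite !inE; lia.
have := lt b bn; rewrite (bigID (fun x : 'I_n => x < a)) /=.
rewrite (eq_bigl (fun x : 'I_n => x < a)); last by move=> x /=; lia.
rewrite lt; last by lia.
move=> eqb; have -> : #|[set x : 'I_n | a <= x < b]| =
    \sum_(x < n | (x < b) && ~~ (x < a)) 1.
  by rewrite sum1_card; apply: eq_card => x; rewrite inE [RHS]unfold_in; lia.
by apply: (@addnI a); rewrite subnKC.
Qed.

Lemma eq_modn_close (m a b : nat) :
  a <= b -> b < a + m -> a = b %[mod m] -> a = b.
Proof.
move=> ab lt /esym/eqP; rewrite eqn_mod_dvd // => /dvdn_leq dv.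
by have [|] := posnP (b - a); [lia | move/dv; lia].
Qed.

Lemma eq_modn_next (m a b : nat) :
  a < b -> b < a + m + m -> a = b %[mod m] -> b = a + m.
Proof.
move=> ab lt; have [le|gt] := leqP (a + m) b; last first.
  by move/(eq_modn_close (ltnW ab) gt) => e; rewrite e ltnn in ab.
by rewrite -[a %% m]modnDr => /(eq_modn_close le lt).
Qed.

Lemma sum_step (k s P q : nat) : k <= s ->
  \sum_(i < s) (if i < k then P else q) = k * P + (s - k) * q.
Proof.
elim: s k => [|s IH] k ks; first by rewrite big_ord0; have -> : k = 0 by lia.
rewrite big_ord_recr /=; have [ks'|sk] := leqP k s.
  by rewrite IH // subSn //; lia.
have -> : k = s.+1 by lia.
rewrite (eq_bigr (fun _ => P)) => [|i _]; last by rewrite ltnS ltnW.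
by rewrite sum_nat_const card_ord; lia.
Qed.

(** * Stable families: links above [s] *)

Section Stable.

Variables (n s : nat) (H : {set {set 'I_n}}).
Hypotheses (s_gt0 : 0 < s) (n_ge : 7 * s + 6 <= n).
Hypothesis H3 : H \subset ksubsets 'I_n 3.
Hypothesis H_stable : forall i j : 'I_n, i < j -> shift i j H = H.
Hypothesis nuH : forall l, matching H l -> size l <= s.

Variable os : 'I_n.
Hypothesis os_val : os = s :> nat.
Local Notation m := (n - s.+1).
Notation h := (triple H).

Lemma triple_neq x y z : h x y z -> [/\ x != y, x != z & y != z].
Proof. by move/(subsetP H3); rewrite inE => /eqP/set3P. Qed.

(** A set containing [x] but not [x'] stays in the shift only if its swap is in [H] too; so an
    element of a member may be lowered to any smaller value not already present. *)
Lemma triple_stable (x' x y z : 'I_n) :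
  h x y z -> x' < x -> x' != y -> x' != z -> h x' y z.
Proof.
move=> hxyz lt x'y x'z; have [xy xz yz] := triple_neq hxyz.
have ne : x' != x by apply: contraTneq lt => ->; rewrite ltnn.
have := hxyz; rewrite /triple -{1}(H_stable lt) inE !inE !eqxx (negbTE ne).
rewrite (negbTE x'y) (negbTE x'z) /= => /andP[_].
by rewrite -(@swap_set3 _ x' x) ?swapK // eq_sym.
Qed.

(** Lowering the three elements would put into [H] every triple with one element in [0..s] and two
    in [s+1..3s+2]. These [2s+2] upper elements suffice for [s+1] disjoint triples. *)
Lemma triple_high x y z :
  h x y z -> s < x -> 3 * s < y -> 3 * s < z -> False.
Proof.
(* With [y < z], one has [y >= 3s+1] and [z >= 3s+2], so [y] and [z] dominate any [p < q] in [R]. *)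
wlog yz : y z / y < z.
  move=> th hxyz sx y3 z3; have [_ _ /eqP/val_eqP yz] := triple_neq hxyz.
  case: (ltngtP y z) => [lt|lt|eq]; first exact: (th y z).
    by apply: (th z y) => //; rewrite tripleAC.
  by rewrite /= eq eqxx in yz.
move=> hxyz sx y3 z3.
pose S := [set u : 'I_n | 0 <= u < s.+1].
pose R := [set u : 'I_n | s.+1 <= u < 3 * s + 3].
have cS : #|S| = s.+1 by rewrite card_interval //; lia.
have cR : #|R| = 2 * s.+1 by rewrite card_interval; lia.
have [||| l [lH sl _]] := @star_matching _ H S R.
- move=> u uS p q pR qR pq; rewrite -/(triple H u p q).
  wlog lt : p q pR qR pq / p < q.
    move=> th; case: (ltngtP p q) => [lt|lt|/val_inj eq]; first exact: th.
      by rewrite tripleAC; apply: th => //; rewrite eq_sym.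
    by rewrite eq eqxx in pq.
  move: uS pR qR; rewrite !inE => us p3 q3.
  have ne (a b : 'I_n) : (a : nat) != b -> a != b by [].
  have hu : h u y z by apply: (triple_stable hxyz); [|apply: ne..]; lia.
  have hp : h u p z.
    have [->//|py] := eqVneq p y.
    rewrite tripleC; apply: (@triple_stable _ y); first by rewrite tripleC.
    - by move: py; rewrite -val_eqE /=; lia.
    - by apply: ne; lia.
    - by apply: ne; lia.
  have [->//|qz] := eqVneq q z.
  rewrite tripleAC tripleC; apply: (@triple_stable _ z).
  + by rewrite tripleC tripleAC.
  + by move: qz; rewrite -val_eqE /=; lia.
  + by apply: ne; lia.
  + by rewrite eq_sym.
- by rewrite -setI_eq0; apply/eqP/setP => u; rewrite !inE; lia.
- by rewrite cS cR.
by have := nuH lH; rewrite sl cS ltnn.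
Qed.

(** Ordered pairs are counted, so this is [g_x], twice the number of edges of the link graph. *)
Definition link (x : 'I_n) : nat :=
  \sum_(y : 'I_n | s < y) \sum_(z : 'I_n | s < z) h x y z.

Lemma triple_link (x y z : 'I_n) : s < x -> s < y -> s < z -> h x y z -> h os y z.
Proof.
move=> sx sy sz /triple_stable; apply=> //; rewrite -?val_eqE /= os_val //; lia.
Qed.

(* At most one element of a member of [H] avoiding [0..s] exceeds [3 * s]. *)
Lemma sum_high_triples :
  \sum_(x : 'I_n | s < x) \sum_(y : 'I_n | s < y) \sum_(z : 'I_n | s < z) h x y z
    <= 3 * s * link os.
Proof.
pose t (x y z : 'I_n) := (x <= 3 * s) * h x y z.
pose B := \sum_(x : 'I_n | s < x) \sum_(y : 'I_n | s < y)
           \sum_(z : 'I_n | s < z) t x y z.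
(* Only the [2s] values [s < x <= 3s] contribute, and each of their links lies inside that of
   [os]. *)
have leB : B <= 2 * s * link os.
  have -> : 2 * s * link os = \sum_(x : 'I_n | s < x < 3 * s + 1) link os.
    rewrite sum_nat_const; congr (_ * _).
    have -> : 2 * s = #|[set x : 'I_n | s.+1 <= x < 3 * s + 1]|.
      by rewrite card_interval; lia.
    by apply: eq_card => x; rewrite inE [RHS]unfold_in.
  rewrite /B (bigID (fun x : 'I_n => x < 3 * s + 1)) /= [X in _ + X]big1.
    rewrite addn0; apply: leq_sum => x /andP[sx _].
    apply: leq_sum => y sy; apply: leq_sum => z sz; rewrite /t.
    case hxyz: (h x y z); last by rewrite muln0.
    by rewrite (triple_link sx sy sz hxyz); case: (x <= _).
  move=> x /andP[_ lt]; rewrite big1 // => y _; rewrite big1 // => z _.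
  by rewrite /t (_ : x <= 3 * s = false) ?mul0n //; lia.
pose D (f : 'I_n -> 'I_n -> 'I_n -> nat) := \sum_(x : 'I_n | s < x)
  \sum_(y : 'I_n | s < y) \sum_(z : 'I_n | s < z) f x y z.
have DD f g : D (fun x y z => f x y z + g x y z) = D f + D g.
  rewrite /D -big_split; apply: eq_bigr => x _; rewrite -big_split.
  by apply: eq_bigr => y _; rewrite -big_split.
have eB : D (fun x y z => t y x z) = B by rewrite /D exchange_big.
have eB' : D (fun x y z => t z x y) = B.
  by rewrite -eB; apply: eq_bigr => x _; rewrite exchange_big.
(* At least two of the three coordinates are at most [3s], and by symmetry each coordinate accounts
   for [B]. *)
suff : 2 * D h <= 3 * B by move: leB; rewrite -/(D h); clear; lia.
have -> : 3 * B = D (fun x y z => t x y z + t y x z + t z x y).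
  by rewrite !DD eB eB' -/(D t) -[D t]/B; lia.
rewrite big_distrr; apply: leq_sum => x sx; rewrite big_distrr.
apply: leq_sum => y sy; rewrite big_distrr; apply: leq_sum => z sz /=.
rewrite /t [h y x z]tripleC [h z x y]tripleC [h x z y]tripleAC.
have := @triple_high x y z; have := @triple_high y x z; have := @triple_high z x y.
rewrite [h y x z]tripleC [h z x y]tripleC [h x z y]tripleAC.
case: (h x y z) => //= h1 h2 h3; rewrite !muln1.
have := h1 isT sz; have := h2 isT sy; have := h3 isT sx; clear.
case: (leqP x (3 * s)); case: (leqP y (3 * s)); case: (leqP z (3 * s)) =>
  //= _ _ _ g1 g2 g3.
all: by [case: (g1 isT isT) | case: (g2 isT isT) | case: (g3 isT isT)].
Qed.

(** * Splitting the pairs above [s] into matchings by their sum modulo [m] *)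

Definition sumclass (c : nat) : {set 'I_n * 'I_n} :=
  [set e : 'I_n * 'I_n | [&& s < e.1, s < e.2, e.1 != e.2 & (e.1 + e.2) %% m == c]].

Definition sumclass_link (x : 'I_n) (c : nat) : {set 'I_n * 'I_n} :=
  [set e in sumclass c | h x e.1 e.2].

Lemma sumclass_sym c y z : (y, z) \in sumclass c -> (z, y) \in sumclass c.
Proof. by rewrite !inE /= eq_sym addnC => /and4P[-> -> -> ->]. Qed.

(** The elements above [s] are [m] consecutive integers and represent each residue once; hence every
    class is a matching. *)
Lemma sumclass_fun c y z z' :
  (y, z) \in sumclass c -> (y, z') \in sumclass c -> z = z'.
Proof.
rewrite !inE /= => /and4P[_ sz _ /eqP ez] /and4P[_ sz' _ /eqP ez'].
have lz := ltn_ord z; have lz' := ltn_ord z'.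
have /eqP : y + z = y + z' %[mod m] by rewrite ez ez'.
rewrite eqn_modDl => /eqP; move: sz sz' lz lz'; clear => sz sz' lz lz' emod.
apply: val_inj => /=; have [le|/ltnW le] := leqP z z'.
  by apply: eq_modn_close emod => //; lia.
by apply/esym; apply: eq_modn_close (esym emod) => //; lia.
Qed.

(** Each [y] above [s] has the partner of residue [c - y], unless it is its own partner, which
    happens for at most two [y]. *)
Lemma card_sumclass c : c < m -> m - 2 <= #|sumclass c|.
Proof.
move=> cm; pose D := [set y : 'I_n | s.+1 <= y < n].
pose D2 := [set y : 'I_n | (s < y) && ((y + y) %% m == c)].
have cD : #|D| = m by rewrite card_interval.
have cD2 : #|D2| <= 2.
  rewrite leqNgt; apply/negP => /card_gt2P[x [y [z [[xD yD zD] [xy yz zx]]]]].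
  (* The doubles are congruent and less than [2 m] apart, so distinct ones differ by exactly [m];
     this is impossible among three elements. *)
  have key (u v : 'I_n) : u \in D2 -> v \in D2 -> u < v -> v + v = u + u + m.
    rewrite !inE => /andP[su /eqP eu] /andP[sv /eqP ev] uv.
    have lv := ltn_ord v.
    have emod : u + u = v + v %[mod m] by rewrite eu ev.
    by apply: eq_modn_next emod; move: su sv uv lv; clear; lia.
  have := key x y xD yD; have := key y x yD xD; have := key x z xD zD.
  have := key z x zD xD; have := key y z yD zD; have := key z y zD yD.
  by move: xy yz zx; rewrite -!val_eqE /=; clear; lia.
apply: leq_trans (leq_imset_card (fun e : 'I_n * 'I_n => e.1) (sumclass c)).
have sub : D :\: D2 \subset [set e.1 | e in sumclass c].
  apply/subsetP => y; rewrite !inE => /andP[nD2 /andP[sy _]].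
  (* [w] represents [c - (y + s + 1)] modulo [m]; the multiple of [m] keeps the subtraction from
     truncating. *)
  rewrite sy /= in nD2; pose w := c + m * (y + s.+1) - (y + s.+1).
  have m0 : 0 < m by lia.
  have ltz : s.+1 + w %% m < n by have := ltn_pmod w m0; rewrite ltn_subRL; clear; lia.
  have ez : (y + Ordinal ltz) %% m = c.
    rewrite /= addnA modnDmr /w subnKC; last by nia.
    by rewrite addnC mulnC modnMDl modn_small.
  apply/imsetP; exists (y, Ordinal ltz) => //; rewrite !inE /= sy ez eqxx.
  rewrite leq_addr andbT /=; apply: contraNneq nD2 => ey.
  by rewrite {2}ey ez.
apply: leq_trans (subset_leq_card sub).
have := cardsID D2 D; have := subset_leq_card (subsetIr D D2); lia.
Qed.

(* Nestedness lets one pick edges of [sumclass_link x c] greedily for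
   x = s, s-1, ..., 0, each pick ruling out only two ordered pairs. *)
Lemma rainbow_free c : exists2 x : 'I_n, x <= s & #|sumclass_link x c| <= 2 * (s - x).
Proof.
apply/exists_inP; apply: contraT; rewrite negb_exists_in => /forall_inP big.
(* [U] collects the pairs of the class touched so far. The clause on [x <= s] says that only the top
   [k] elements of [0..s] are used, leaving [s - k] free for the next pick. *)
suff greedy k : k <= s.+1 -> exists l (U : {set 'I_n * 'I_n}),
    [/\ matching H l, size l = k, #|U| <= 2 * k,
        forall A x, A \in l -> x \in A -> x <= s -> s < x + k &
        forall A e, A \in l -> e \in sumclass c -> e \notin U ->
          (e.1 \notin A) && (e.2 \notin A)].
  have [l [U [/nuH + sl _ _ _]]] := greedy s.+1 (leqnn _).
  by rewrite sl ltnn.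
elim: k => [|k IH] ks.
  by exists [::], set0; rewrite cards0.
have [l [U [lH sl cU low avoid]]] := IH (ltnW ks).
have ltxn : s - k < n by lia.
pose x := Ordinal ltxn; have xs : x <= s by rewrite /= leq_subr.
have := big x xs; rewrite -ltnNge /= subKn // => lt.
have /set0Pn[[y z]] : sumclass_link x c :\: U != set0.
  rewrite -card_gt0 cardsD subn_gt0; apply: leq_ltn_trans lt.
  by apply: leq_trans cU; apply: subset_leq_card (subsetIr _ _).
rewrite in_setD [in X in _ && X]inE => /andP[yzU /andP[yzc hxyz]] /=.
have := yzc; rewrite inE /= => /and4P[sy sz yz _].
have zyc := sumclass_sym yzc.
exists ([set x; y; z] :: l), ((y, z) |: ((z, y) |: U)); split.
- case/andP: lH => lH dl; rewrite /matching /= lH dl !andbT; apply/andP; split=> //.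
  apply/allP => A Al; rewrite -setI_eq0; apply/eqP/setP => v; rewrite in_setI in_set0.
  have /andP[/= yA zA] := avoid A (y, z) Al yzc yzU.
  apply/negP => /andP[+ vA]; rewrite !inE => /orP[/orP[]|]/eqP ev; subst v.
  + by have := low A x Al vA xs; rewrite /= subnK ?ltnn.
  + by rewrite vA in yA.
  + by rewrite vA in zA.
- by rewrite /= sl.
- rewrite !cardsU1 mulnS.
  exact: leq_add (leq_b1 _) (leq_add (leq_b1 _) cU).
- move=> A v; rewrite inE addnS ltnS => /orP[/eqP->|Al vA vs].
    rewrite !inE => /orP[/orP[]|]/eqP-> _.
    + by rewrite /= subnK.
    + exact: leq_trans (ltnW sy) (leq_addr _ _).
    + exact: leq_trans (ltnW sz) (leq_addr _ _).
  exact: ltnW (low A v Al vA vs).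
move=> A [y' z']; rewrite inE => /orP[/eqP->|Al] ec; rewrite !inE !negb_or =>
  /and3P[n1 n2 n3]; last exact: avoid.
have := ec; rewrite inE /= => /and4P[sy' sz' _ _].
have zc' := sumclass_sym ec.
have nx (v : 'I_n) : s < v -> v != x by apply: contraTneq => ->; rewrite -leqNgt.
rewrite !nx //= -andbA; apply/and4P; split.
- apply: contraNneq n1 => e1; rewrite e1 in ec *; by rewrite (sumclass_fun ec yzc).
- apply: contraNneq n2 => e1; rewrite e1 in ec *; by rewrite (sumclass_fun ec zyc).
- apply: contraNneq n2 => e1; rewrite e1 in zc' *; by rewrite (sumclass_fun zc' yzc).
- apply: contraNneq n1 => e1; rewrite e1 in zc' *; by rewrite (sumclass_fun zc' zyc).
Qed.

(** Take [x0] from [rainbow_free]. By nestedness every link from [x0] to [s] has at most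
    [2 * (s - x0)] pairs in the class; below [x0] the size of the class itself is the bound. *)
Lemma sumclass_bound c : c < m ->
  2 * (\sum_(x : 'I_n | x < s) #|sumclass_link x c|) +
    (3 * s + 4) * #|sumclass_link os c| <= 2 * s * #|sumclass c|.
Proof.
move=> cm; have cP := card_sumclass cm; have [x0 x0s cx0] := rainbow_free c.
have low (x : 'I_n) : x0 <= x -> x <= s -> #|sumclass_link x c| <= 2 * (s - x0).
  move=> lex xs; apply: leq_trans cx0; apply: subset_leq_card.
  apply/subsetP => -[y z]; rewrite !inE /= => /andP[/and4P[sy sz -> ->] hxyz].
  rewrite sy sz /=; move: lex; rewrite leq_eqVlt => /orP[/eqP/val_inj->//|lt].
  by apply: (triple_stable hxyz) => //; apply/negP => /eqP ex;
    move: x0s; rewrite ex leqNgt ?sy ?sz.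
have lsum : \sum_(x : 'I_n | x < s) #|sumclass_link x c| <=
    x0 * #|sumclass c| + (s - x0) * (2 * (s - x0)).
  rewrite -(sum_step _ _ x0s).
  have sn : s <= n by lia.
  rewrite (big_ord_widen n (fun i => if i < x0 then _ else _) sn).
  apply: leq_sum => x xs; case: leqP => xx0; first exact: low xx0 (ltnW xs).
  by apply: subset_leq_card; apply/subsetP => e; rewrite inE => /andP[].
have := low os; rewrite os_val => /(_ x0s (leqnn s)) los.
(* For [x0 < s] this asks the class to have at least [2 (s - x0) + 3s + 4 <= 5s + 4] pairs. It has
   at least [m - 2 >= 6s + 3] because [n >= 7s + 6], which is enough as [s >= 1]. *)
have jP : (s - x0) * (2 * (s - x0) + 3 * s + 4) <= (s - x0) * #|sumclass c|.
  by rewrite leq_mul2l; apply/orP; right; lia.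
move: los jP lsum; move: #|_| (\sum_(_ < n | _) _) #|_| => a b d.
move: x0s; clear; move: (x0 : nat) => j; nia.
Qed.

Lemma sum_high_pairs (f : 'I_n -> 'I_n -> nat) :
    (forall x, f x x = 0) ->
  \sum_(y : 'I_n | s < y) \sum_(z : 'I_n | s < z) f y z =
  \sum_(c < m) \sum_(e in sumclass c) f e.1 e.2.
Proof.
move=> f0; have m0 : 0 < m by lia.
rewrite pair_big /= (bigID (fun e : 'I_n * 'I_n => e.1 == e.2)) /= big1 ?add0n.
  rewrite (partition_big (fun e : 'I_n * 'I_n =>
    Ordinal (ltn_pmod (e.1 + e.2) m0)) xpredT) //=.
  apply: eq_bigr => c _; apply: eq_bigl => e.
  by rewrite inE -val_eqE /= -!andbA.
by case=> y z /andP[_ /= /eqP->].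
Qed.

Lemma link_sum x : link x = \sum_(c < m) #|sumclass_link x c|.
Proof.
rewrite /link sum_high_pairs; last first.
  by move=> y; case hyy: (h x y y) => //; case/triple_neq: hyy; rewrite eqxx.
apply: eq_bigr => c _; rewrite -sum1_card [RHS]big_mkcond [LHS]big_mkcond /=.
by apply: eq_bigr => e _; rewrite [e \in sumclass_link _ _]inE; case: (e \in _);
  case: (h _ _ _).
Qed.

Lemma card_high : #|[set y : 'I_n | s < y]| = m.
Proof.
by rewrite -(@card_interval n s.+1 n) //; apply: eq_card => y;
  rewrite !inE ltn_ord andbT.
Qed.

Lemma sum_sumclass : \sum_(c < m) #|sumclass c| = m * m.-1.
Proof.
transitivity (\sum_(y : 'I_n | s < y) \sum_(z : 'I_n | s < z) (y != z : nat)).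
  rewrite sum_high_pairs; last by move=> y; rewrite eqxx.
  apply: eq_bigr => c _; rewrite -sum1_card; apply: eq_bigr => e.
  by rewrite inE => /and4P[_ _ -> _].
transitivity (\sum_(y : 'I_n | s < y) m.-1).
  apply: eq_bigr => y sy; rewrite -card_high (cardsD1 y) inE sy /=.
  rewrite -sum1_card [RHS]big_mkcond [LHS]big_mkcond /=; apply: eq_bigr => z _.
  by rewrite !inE eq_sym; case: (z == y); case: (s < z).
rewrite sum_nat_const -card_high; congr (_ * _).
by apply: eq_card => y; rewrite !inE.
Qed.

Lemma link_bound :
  2 * (\sum_(x : 'I_n | x < s) link x) + (3 * s + 4) * link os <=
  2 * s * (m * m.-1).
Proof.
rewrite (eq_bigr _ (fun x _ => link_sum x)) exchange_big /= link_sum.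
rewrite -sum_sumclass !big_distrr -big_split /=.
by apply: leq_sum => c _; apply: sumclass_bound.
Qed.

(** * The excess of a stable family *)

Lemma excess_stable :
  2 * excess s H + link os <= (s * s.+1 + 2 * s * m) * m.-1.
Proof.
pose d (x y : 'I_n) := \sum_z h x y z.
have dC x y : d x y = d y x by apply: eq_bigr => z _; rewrite tripleC.
have dxx x : d x x = 0.
  by apply: big1 => z _; case hxx: (h x x z) => //; case/triple_neq: hxx; rewrite eqxx.
have -> : 2 * excess s H = \sum_x \sum_y (d x y - s).
  rewrite sum_pairs; apply: eq_bigr => x _; rewrite [RHS](bigD1 x) //= dxx add0n.
  by apply: eq_bigr => y yx; rewrite degree_pair // eq_sym.
have low_card : #|[set y : 'I_n | y < s.+1]| = s.+1.
  rewrite -[RHS](@card_interval n 0 s.+1) ?subn0; last by lia.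
  by apply: eq_card => y; rewrite !inE.
(* A degree is at most [n - 2], and [n - 2 - s] equals [m.-1]. *)
have dlow x y : d x y - s <= (x != y) * m.-1.
  have [->|xy] := eqVneq x y; first by rewrite dxx.
  rewrite mul1n leq_subLR; apply: leq_trans (_ : #|~: [set x; y]| <= _); last first.
    by have := cardsC [set x; y]; rewrite cards2 xy card_ord; lia.
  rewrite -sum1_card [leqRHS]big_mkcond; apply: leq_sum => z _ /=.
  case hxyz: (h x y z) => //; case/triple_neq: hxyz => _ xz yz.
  by rewrite !inE negb_or ![z == _]eq_sym xz yz.
have split_d x y : d x y = \sum_(z : 'I_n | z < s.+1) h x y z +
    \sum_(z : 'I_n | s < z) h x y z.
  rewrite /d (bigID (fun z : 'I_n => z < s.+1)) /=; congr (_ + _).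
  by apply: eq_bigl => z; rewrite ltnS -ltnNge.
(* One element of [0..s] that does not complete the pair leaves at most [s] that do, and these are
   absorbed by subtracting [s]. *)
have low_le (x y v : 'I_n) : v <= s -> ~~ h x y v ->
    \sum_(z : 'I_n | z < s.+1) h x y z <= s.
  move=> vs nh; rewrite (bigD1 v) //= (negbTE nh) add0n.
  apply: leq_trans (_ : #|[set y : 'I_n | y < s.+1] :\ v| <= _); last first.
    by have := cardsD1 v [set y : 'I_n | y < s.+1]; rewrite inE ltnS vs low_card; lia.
  rewrite -sum1_card [leqRHS]big_mkcond [leqLHS]big_mkcond; apply: leq_sum => z _ /=.
  by rewrite !inE andbC; case: ifP => // _; case: (h _ _ _).
have A : \sum_(x : 'I_n | x < s.+1) \sum_(y : 'I_n | y < s.+1) (d x y - s) <=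
    s.+1 * s * m.-1.
  apply: leq_trans (_ : \sum_(x : 'I_n | x < s.+1) s * m.-1 <= _); last first.
    rewrite sum_nat_const mulnA leq_mul2r; apply/orP; right.
    rewrite leq_mul2r -[leqRHS]low_card; apply/orP; right.
    by apply: subset_leq_card; apply/subsetP => x; rewrite inE.
  apply: leq_sum => x xs; apply: leq_trans (leq_sum _ (fun y _ => dlow x y)) _.
  rewrite -big_distrl /= leq_mul2r; apply/orP; right.
  rewrite (bigD1 x) //= eqxx add0n.
  apply: leq_trans (_ : #|[set y : 'I_n | y < s.+1] :\ x| <= _); last first.
    by have := cardsD1 x [set y : 'I_n | y < s.+1]; rewrite inE xs low_card; lia.
  rewrite -sum1_card [leqRHS]big_mkcond [leqLHS]big_mkcond; apply: leq_sum => z _ /=.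
  by rewrite !inE andbC; case: ifP => // _; case: (_ != _).
(* For a pair with [x] in [0..s], the element that fails to complete it is [x] itself. *)
have B : \sum_(x : 'I_n | x < s.+1) \sum_(y : 'I_n | s < y) (d x y - s) <=
    \sum_(x : 'I_n | x < s.+1) link x.
  apply: leq_sum => x xs; apply: leq_sum => y sy; rewrite split_d.
  rewrite leq_subLR leq_add2r (low_le x y x) //.
  by apply/negP => /triple_neq[_]; rewrite eqxx.
(* For a pair above [s], that element is [os]. If [os] does complete the pair, the one extra unit is
   charged to [link os]. *)
have C : \sum_(x : 'I_n | s < x) \sum_(y : 'I_n | s < y) (d x y - s) <=
    link os + 3 * s * link os.
  apply: leq_trans (leq_add (leqnn _) sum_high_triples).
  rewrite /link -big_split; apply: leq_sum => x sx.
  rewrite -big_split; apply: leq_sum => y sy; rewrite split_d /=.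
  have [hs|nhs] := boolP (h os x y).
    rewrite leq_subLR addnA leq_add2r addn1.
    rewrite -[leqRHS]low_card -sum1_card [leqRHS]big_mkcond [leqLHS]big_mkcond.
    by apply: leq_sum => z _; rewrite /= inE; case: ifP => // _; case: (h _ _ _).
  rewrite add0n leq_subLR leq_add2r (low_le x y os) ?os_val //.
  by rewrite tripleAC tripleC.
have link_split : \sum_(x : 'I_n | x < s.+1) link x =
    link os + \sum_(x : 'I_n | x < s) link x.
  rewrite (bigD1 os) ?os_val //=; congr (_ + _); apply: eq_bigl => x.
  by rewrite -val_eqE /= os_val; lia.
have split_sum (F : 'I_n -> nat) : \sum_y F y =
    \sum_(y : 'I_n | y < s.+1) F y + \sum_(y : 'I_n | s < y) F y.
  rewrite (bigID (fun y : 'I_n => y < s.+1)) /=; congr (_ + _).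
  by apply: eq_bigl => y; rewrite ltnS -ltnNge.
have B' : \sum_(x : 'I_n | s < x) \sum_(y : 'I_n | y < s.+1) (d x y - s) <=
    \sum_(x : 'I_n | x < s.+1) link x.
  apply: leq_trans B; rewrite exchange_big /=; apply: eq_leq.
  by apply: eq_bigr => x _; apply: eq_bigr => y _; rewrite dC.
rewrite split_sum (eq_bigr _ (fun x _ => split_sum (fun y => d x y - s))).
rewrite [X in _ + X + _](eq_bigr _ (fun x _ => split_sum (fun y => d x y - s))).
(* The mixed blocks contribute [2 * link os] and the upper block [3s+1] times it; the summand in the
   statement raises this to the [3s+4] of [link_bound]. *)
rewrite !big_split /=; move: A B B' C link_bound; rewrite link_split.
move: (link os) (\sum_(x : 'I_n | x < s) link x) => lo ls.
do 4![move: (\sum_(x : 'I_n | _) \sum_(y : 'I_n | _) _) => ?].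
by clear; move: m.-1 m => m1 m2; nia.
Qed.


(** A member missing [0..s-1] has two elements above [s], and its third is [os] or can be lowered to
    [os]; either way it would contribute to [link os]. *)
Lemma stable_sub_star : link os = 0 -> H \subset star (initial_set n s).
Proof.
move=> link0; have noh (y z : 'I_n) : s < y -> s < z -> h os y z = false.
  move=> sy sz; move/eqP: link0; rewrite /link sum_nat_eq0 => /forall_inP/(_ y sy).
  by rewrite sum_nat_eq0 => /forall_inP/(_ z sz); case: (h os y z).
apply/subsetP => A AH; have := subsetP H3 A AH; rewrite inE => cA.
rewrite mem_star cA /=; apply/negP => /eqP AS.
have As y : y \in A -> s <= y.
  by move=> yA; rewrite leqNgt; apply/negP => ys; move/setP/(_ y): AS;
    rewrite !inE yA ys.
have [x xA xos] : exists2 x, x \in A & (os \in A -> x = os).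
  have [?|nA] := boolP (os \in A); first by exists os.
  have /card_gt0P[x xA] : 0 < #|A| by rewrite (eqP cA).
  by exists x.
have := cardsD1 x A; rewrite (eqP cA) xA => -[/esym/eqP/cards2P[y [z [yz eqA]]]].
have high v : v \in A :\ x -> s < v.
  rewrite !inE => /andP[vx vA]; rewrite ltn_neqAle As // andbT -os_val eq_sym.
  by apply: contraNneq vx => /val_inj vos; rewrite vos xos // -vos.
have sy : s < y by apply: high; rewrite eqA !inE eqxx.
have sz : s < z by apply: high; rewrite eqA !inE eqxx orbT.
have hxyz : h x y z by rewrite /triple -setUA -eqA setD1K.
have := As x xA; rewrite leq_eqVlt => /orP[/eqP sx|sx].
  have xo : x = os by apply: val_inj; rewrite /= os_val.
  by have := noh y z sy sz; rewrite -xo hxyz.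
by have := noh y z sy sz; rewrite (triple_link sx sy sz hxyz).
Qed.
End Stable.

(** * Degrees and excess of a star *)

Lemma degree_star (n : nat) (S : {set 'I_n}) (x y : 'I_n) : x != y ->
  degree (star S) [set x; y] = if (x \in S) || (y \in S) then n - 2 else #|S|.
Proof.
move=> xy; have starU : star S \subset ksubsets 'I_n 3.
  by apply/subsetP => A; rewrite inE => /andP[].
rewrite degree_pair //; case: ifP => [xyS|/norP[xS yS]].
  rewrite (_ : n - 2 = #|~: [set x; y]|); last first.
    by have := cardsC [set x; y]; rewrite cards2 xy card_ord; clear; lia.
  rewrite -sum1_card [RHS]big_mkcond; apply: eq_bigr => z _.
  rewrite in_setC in_set2 negb_or; have [/andP[zx zy]|] := boolP (_ && _).
    have c3 : #|[set x; y; z]| = 3 by rewrite card_set3 // eq_sym.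
    by rewrite set3_star // orbA xyS.
  rewrite negb_and !negbK => zxy; suff -> : [set x; y; z] \in star S = false by [].
  apply/negP => /(subsetP starU); rewrite inE => /eqP/set3P[_ xz yz].
  by move: zxy; rewrite eq_sym (negbTE xz) eq_sym (negbTE yz).
rewrite -sum1_card [RHS]big_mkcond; apply: eq_bigr => z _.
have [zS|zS] := boolP (z \in S).
  rewrite set3_star ?zS ?orbT // card_set3 //.
    by apply: contraNneq xS => ->.
  by apply: contraNneq yS => ->.
suff -> : [set x; y; z] \in star S = false by [].
apply/negP => H; have := subsetP starU _ H; rewrite inE => /eqP c3.
by move: H; rewrite set3_star // (negbTE xS) (negbTE yS) (negbTE zS).
Qed.

Lemma excess_star (n s : nat) (S : {set 'I_n}) : s < n -> #|S| = s ->
  2 * excess s (star S) = (s * s.+1 + 2 * s * (n - s.+1)) * (n - s.+1).-1.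
Proof.
move=> sn cS; have em : n - 2 - s = (n - s.+1).-1 by lia.
have row (x : 'I_n) : \sum_(y | y != x) (degree (star S) [set x; y] - s) =
    (if x \in S then n.-1 else s) * (n - s.+1).-1.
  transitivity (\sum_(y | y != x) (if (x \in S) || (y \in S) then (n - s.+1).-1
    else 0)).
    apply: eq_bigr => y yx; rewrite degree_star; last by rewrite eq_sym.
    by case: ifP => _; rewrite ?em // cS subnn.
  case: ifP => xS /=.
    rewrite sum_nat_const; congr (_ * _).
    by have := cardC1 x; rewrite card_ord => e; rewrite -[RHS]e;
      apply: eq_card => y; rewrite !inE.
  rewrite -big_mkcondr /= sum_nat_const; congr (_ * _).
  rewrite -cS; apply: eq_card => y; rewrite unfold_in.
  by case yS: (y \in S); rewrite ?andbF // andbT; apply: contraFneq xS => <-.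
rewrite sum_pairs (eq_bigr _ (fun x _ => row x)) -big_distrl /=; congr (_ * _).
rewrite (bigID (fun x => x \in S)) /= (eq_bigr (fun _ => n.-1)); last by move=> x ->.
rewrite sum_nat_const cS [X in _ + X](eq_bigr (fun _ => s)); last by move=> x /negbTE->.
rewrite sum_nat_const; have -> : #|[pred x | x \notin S]| = n - s.
  transitivity #|[predC S]|; first exact: eq_card.
  by have := cardC S; rewrite card_ord cS; clear; lia.
by case: n {S cS em row} sn => // n; rewrite ltnS subSS => sn; nia.
Qed.

(** * Maximality and uniqueness for the excess *)

Lemma degree_sub (T : finType) (H G : {set {set T}}) (E : {set T}) :
  H \subset G -> degree H E <= degree G E.
Proof.
by move=> HG; apply/subset_leq_card/subsetP => A; rewrite !inE =>
  /andP[/(subsetP HG)-> ->].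
Qed.

(** A missing triple lowers the degree of one of its pairs meeting [S]. In the star that degree is
    [n - 2 > s], so the excess drops strictly. *)
Lemma excess_sub_star (n s : nat) (S : {set 'I_n}) (H : {set {set 'I_n}}) :
    s + 2 < n -> H \subset star S -> excess s (star S) <= excess s H ->
  H = star S.
Proof.
move=> sn HS le; apply/eqP; rewrite eqEsubset HS; apply/subsetP => A AS.
apply: contraT => AH; move: le; rewrite leqNgt => /negP; case.
have := AS; rewrite mem_star => /andP[/eqP c3 /set0Pn[u]]; rewrite inE => /andP[uA uS].
have := cardsD1 u A; rewrite c3 uA => -[/esym/eqP/cards2P[v [w [vw eqA]]]].
have : v \in A :\ u by rewrite eqA !inE eqxx.
rewrite !inE => /andP[vu vA]; have uv : u != v by rewrite eq_sym.
have E2 : [set u; v] \in ksubsets 'I_n 2 by rewrite inE cards2 uv.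
have lt : degree H [set u; v] < degree (star S) [set u; v].
  apply/proper_card/properP; split.
    apply/subsetP => B /setIdP[BH uvB]; apply/setIdP; split=> //.
    exact: subsetP HS B BH.
  exists A; last by apply: contra AH => /setIdP[].
  by apply/setIdP; split=> //; apply/subsetP => z; rewrite !inE => /orP[]/eqP->.
rewrite /excess (bigD1 _ E2) [X in _ < X](bigD1 _ E2) /= -addSn leq_add //.
  by move: lt; rewrite degree_star // uS /=; clear - sn; lia.
by apply: leq_sum => E _; apply/leq_sub2r/degree_sub.
Qed.

(** Induction on [weight]: a shift that changes [H] passes the bound back by [excess_shift] and the
    equality case by [shift_star]; if no shift does, [H] is stable. *)
Lemma excess_max (n s : nat) (H : {set {set 'I_n}}) :
    0 < s -> 7 * s + 6 <= n -> H \subset ksubsets 'I_n 3 ->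
    (forall l, matching H l -> size l <= s) ->
  excess s H <= excess s (Hfam n 3 s) /\
  (excess s (Hfam n 3 s) <= excess s H ->
   exists2 S : {set 'I_n}, #|S| = s & H = star S).
Proof.
move=> s0 ns; have sn : s < n by lia.
have cS : #|initial_set n s| = s.
  rewrite -[RHS]subn0 -(card_interval 0 (ltnW sn)).
  by apply: eq_card => x; rewrite !inE.
rewrite -[Hfam n 3 s]/(star (initial_set n s)); set X := excess s (star _).
have [k] := ubnP (weight H); elim: k H => // k IH H; rewrite ltnS => wk H3 nuH.
have [/existsP[i /existsP[j /andP[ij neH]]]|stable] :=
    boolP [exists i : 'I_n, exists j : 'I_n, (i < j) && (shift i j H != H)].
  have [|||le eq] := IH (shift i j H).
  - exact: leq_trans (weight_shift ij neH) wk.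
  - exact: shift_uniform.
  - by move=> l /shift_matching[/nuH|/nuH]; rewrite ?size_map.
  have leH := excess_shift i j s H.
  split=> [|geH]; first exact: leq_trans leH le.
  have [S cS' eqS] := eq (leq_trans geH leH).
  have [||||S' cS'' ->] := shift_star (_ : i != j) _ _ H3 _ eqS.
  - by rewrite -val_eqE neq_ltn ij.
  - by rewrite cS'.
  - by rewrite cS' card_ord; lia.
  - by rewrite cS'.
  by exists S' => //; rewrite cS''.
have H_stable (i j : 'I_n) : i < j -> shift i j H = H.
  move=> ij; apply/eqP; apply: contraNT stable => ne.
  by apply/existsP; exists i; apply/existsP; exists j; rewrite ij.
pose o := Ordinal sn.
have := excess_stable s0 ns H3 H_stable nuH (erefl : o = s :> nat).
rewrite -(excess_star sn cS) -/X => bound; split=> [|geH].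
  by rewrite -(leq_pmul2l (isT : 0 < 2)); apply: leq_trans bound; apply: leq_addr.
have link0 : link s H o = 0 by move: bound geH; clear; lia.
exists (initial_set n s) => //; apply: excess_sub_star geH; first by lia.
exact: stable_sub_star link0.
Qed.

(** * The chord inequality: from excess to sums of powers *)

Lemma leq_exp_base (p a b : nat) : a <= b -> a ^ p <= b ^ p.
Proof. by case: p => // p ab; rewrite leq_exp2r. Qed.

(* The chord of [x^p] over [s, N] lies above it there; below [s] the slope
   [s^(p-1)] of the chord from [0] takes over. *)
Lemma exp_chord (s N d p : nat) : 0 < p -> d <= N -> s < N ->
  (N - s) * d ^ p <= (N - s) * s ^ p.-1 * minn d s + (N ^ p - s ^ p) * (d - s).
Proof.
case: p => // p _ dN sN /=; have [ds|/ltnW sd] := leqP d s.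
  rewrite (eqP (_ : d - s == 0)) ?subn_eq0 // muln0 addn0 -mulnA leq_mul2l.
  by rewrite expnSr leq_mul2r leq_exp_base ?orbT.
rewrite -mulnA -expnSr -{1}(subnKC (leq_exp_base p.+1 sd)) mulnDr leq_add2l.
(* Both differences of powers factor through their base differences; the cofactors are compared term
   by term using [d <= N]. *)
rewrite !subn_exp mulnCA [leqRHS]mulnAC mulnA [_ * (N - s)]mulnC.
rewrite leq_mul2l; apply/orP; right; apply: leq_sum => i _.
by rewrite leq_mul2r; apply/orP; right; apply: leq_exp_base.
Qed.

Lemma exp_chord_end (s N p d : nat) : 0 < p -> s < N -> d = s \/ d = N ->
  (N - s) * d ^ p = (N - s) * s ^ p.-1 * s + (N ^ p - s ^ p) * (d - s).
Proof.
case: p => // p _ sN dE; rewrite -mulnA -expnSr.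
have le : s ^ p.+1 <= N ^ p.+1 by rewrite leq_exp2r // ltnW.
case: dE => ->; first by rewrite subnn muln0 addn0.
by rewrite [X in _ + X]mulnC -mulnDr subnKC.
Qed.

(** The chord bound summed over all pairs, with [minn d s] weakened to [s]; the factor [n - 2 - s]
    clears the denominator of the slope. *)
Lemma co_chord (n s p : nat) (H : {set {set 'I_n}}) :
    0 < p -> s < n - 2 -> H \subset ksubsets 'I_n 3 ->
  (n - 2 - s) * co p H <=
  (n - 2 - s) * s ^ p.-1 * (#|ksubsets 'I_n 2| * s) +
    ((n - 2) ^ p - s ^ p) * excess s H.
Proof.
move=> p0 sn H3; rewrite /co /excess -sum_nat_const !big_distrr -big_split /=.
apply: leq_sum => E; rewrite inE => /cards2P[x [y [xy ->]]].
have dle : degree H [set x; y] <= n - 2.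
  rewrite degree_pair //; apply: leq_trans (_ : #|~: [set x; y]| <= _); last first.
    by have := cardsC [set x; y]; rewrite cards2 xy card_ord; clear; lia.
  rewrite -sum1_card [leqRHS]big_mkcond; apply: leq_sum => z _.
  rewrite in_setC in_set2; case hxyz: (_ \in H) => //.
  have := subsetP H3 _ hxyz; rewrite inE => /eqP/set3P[_ xz yz].
  by rewrite ![z == _]eq_sym (negbTE xz) (negbTE yz).
apply: leq_trans (exp_chord p0 dle sn) _.
by rewrite leq_add2r leq_mul2l geq_minr orbT.
Qed.

Lemma co_star (n s p : nat) (S : {set 'I_n}) :
    0 < p -> s < n - 2 -> #|S| = s ->
  (n - 2 - s) * co p (star S) =
  (n - 2 - s) * s ^ p.-1 * (#|ksubsets 'I_n 2| * s) +
    ((n - 2) ^ p - s ^ p) * excess s (star S).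
Proof.
move=> p0 sn cS; rewrite /co /excess -sum_nat_const !big_distrr -big_split /=.
apply: eq_bigr => E; rewrite inE => /cards2P[x [y [xy ->]]].
rewrite degree_star // cS; apply: exp_chord_end => //.
by case: ifP; [right | left].
Qed.

(** * Isomorphism of families *)

Lemma family_iso_co (T : finType) (p : nat) (H G : {set {set T}}) :
  family_iso H G -> co p H = co p G.
Proof.
case=> sigma ->; have inj := imset_inj (@perm_inj _ sigma).
rewrite /co [LHS](reindex_inj inj) /=; apply: eq_big => [E|E _].
  by rewrite !inE card_imset //; apply: perm_inj.
congr (_ ^ _); rewrite /degree -[RHS](card_imset _ inj); apply: eq_card => A.
apply/setIdP/imsetP => [[/imsetP[F FG ->] /subsetP sub]|[F /setIdP[FG EF] ->]].
  exists F => //; apply/setIdP; split=> //; apply/subsetP => x xE.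
  by rewrite -(mem_imset _ _ (@perm_inj _ sigma)) sub // imset_f.
by rewrite imset_f // imsetS.
Qed.

(** Induction on [#|S :\: S'|], exchanging an element of [S] outside [S'] with one of [S'] outside
    [S]. *)
Lemma perm_onto (T : finType) (S S' : {set T}) :
  #|S| = #|S'| -> exists sigma : {perm T}, S = sigma @: S'.
Proof.
have [k] := ubnP #|S :\: S'|; elim: k S => // k IH S; rewrite ltnS => lek cS.
have [eqSS|] := eqVneq S S'.
  exists 1%g; rewrite eqSS; apply/setP => x; rewrite -{2}[x]perm1 mem_imset //.
  exact: perm_inj.
rewrite eqEcard cS leqnn andbT => /subsetPn[x xS xS'].
have /subsetPn[y yS' yS] : ~~ (S' \subset S).
  apply: contra xS' => sub; suff -> : S' = S by [].
  by apply/eqP; rewrite eqEcard sub cS leqnn.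
have [||sigma eqs] := IH (swap x y S).
- apply: leq_trans lek; apply: proper_card; apply/properP; split.
    apply/subsetP => z; rewrite !inE mem_swap.
    by case: tpermP => [->|->|_ _ //]; rewrite ?yS' ?(negbTE yS) ?andbF.
  exists x; rewrite ?inE ?xS ?xS' // mem_swap tpermL (negbTE yS) andbF //.
- by rewrite card_swap.
exists (sigma * tperm x y)%g.
rewrite -[S](@swapK _ x y) eqs /swap -imset_comp; apply: eq_imset => z.
by rewrite /= permM.
Qed.

Lemma family_iso_star (T : finType) (S S' : {set T}) :
  #|S| = #|S'| -> family_iso (star S) (star S').
Proof.
move=> /perm_onto[sigma ->]; exists sigma; apply/setP => A.
have inj := @perm_inj _ sigma.
apply/idP/imsetP => [|[F FS ->]].
  rewrite mem_star => /andP[cA AS]; exists ((sigma^-1)%g @: A).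
    rewrite mem_star card_imset ?cA //=; last exact: perm_inj.
    case/set0Pn: AS => x /setIP[xA /imsetP[y yS eqx]]; apply/set0Pn; exists y.
    by rewrite inE yS andbT; apply/imsetP; exists x; rewrite // eqx permK.
  rewrite -imset_comp -[LHS]imset_id; apply: eq_imset => x.
  by rewrite /= permKV.
move: FS; rewrite !mem_star card_imset // => /andP[-> FS] /=.
by rewrite -imsetI ?imset_eq0 // => x y _ _; apply: inj.
Qed.

Theorem theorem1p9 (n s p : nat) (n_gt0 : 0 < n) (s_ge1 : 1 <= s)
    (p_ge1 : 1 <= p) (n_ge : 7 * s + 6 <= n)
    (H : {set {set 'I_n}}) (H_uniform : H \subset ksubsets 'I_n 3)
    (H_matching : matching_number H = s) :
  co p H <= co p (Hfam n 3 s) /\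
  (co p H = co p (Hfam n 3 s) <-> family_iso H (Hfam n 3 s)).
Proof.
have nuH l : matching H l -> size l <= s.
  rewrite -H_matching; apply: matching_size.
  by apply/negP => /(subsetP H_uniform); rewrite inE cards0.
have cS : #|initial_set n s| = s.
  rewrite -[RHS]subn0 -(@card_interval n 0 s); last by lia.
  by apply: eq_card => x; rewrite !inE.
have sn : s < n - 2 by lia.
have [le_ex eq_ex] := excess_max s_ge1 n_ge H_uniform nuH.
have chordH := co_chord p_ge1 sn H_uniform.
have chordS := co_star p_ge1 sn cS; rewrite -[star _]/(Hfam n 3 s) in chordS.
have d0 : 0 < n - 2 - s by rewrite subn_gt0.
(* The slope is positive, so equal power sums force the excess of [H] up to that of the star. *)
have b0 : 0 < (n - 2) ^ p - s ^ p by rewrite subn_gt0 ltn_exp2r.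
split; [|split=> [eq_co|]].
- rewrite -(leq_pmul2l d0) chordS; apply: leq_trans chordH _.
  by rewrite leq_add2l leq_mul2l le_ex orbT.
- have [|S cS' ->] := eq_ex; last by apply: family_iso_star; rewrite cS' cS.
  by move: chordH; rewrite eq_co chordS leq_add2l leq_pmul2l.
- exact: family_iso_co.
Qed.
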